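(* Let $\mathcal{G}=(X,E)$ be a $d$-uniform hypergraph on $n$ vertices with $d$-dimensional adjacency matrix $\mathbb{A}$, and let $P$ be the color matrix of a coloring $f$ of $\mathcal{G}$ into $k$ colors. Then $f$ is perfect if and only if there exists a $d$-dimensional matrix $\mathbb{S}$ of order $k$ such that $\mathbb{A}\circ P=P\circ\mathbb{S}$. Moreover, in this case the entries of $\mathbb{S}$ are $$s_\gamma=v_{\gamma_1,\gamma}\cdot\binom{d-1}{d_1,\dots,d_k}^{-1},\qquad \gamma=(\gamma_1,\dots,\gamma_d)\in[k]^d.$$ Here $v_{\gamma_1,\gamma}$ is the number of hyperedges whose color range is the multiset $\{\gamma_1,\dots,\gamma_d\}$ and which contain a given vertex of color $\gamma_1$ (this number does not depend on the chosen vertex), $d_l$ is the number of times the color $l$ occurs in the multiset $\{\gamma_2,\dots,\gamma_d\}$, and $\binom{d-1}{d_1,\dots,d_k}$ is the multinomial coefficient.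
   Context: A $d$-uniform hypergraph has a finite vertex set, identified with $[n]=\{1,\dots,n\}$, and hyperedges that are $d$-element subsets of it. Its adjacency matrix $\mathbb{A}$ is the $d$-dimensional array $(a_\alpha)_{\alpha\in[n]^d}$ with $a_{(x_1,\dots,x_d)}=1/(d-1)!$ if $\{x_1,\dots,x_d\}$ is a hyperedge (so the $x_i$ are distinct), and $a_{(x_1,\dots,x_d)}=0$ otherwise. Product $\circ$: let $\mathbb{A}$ be a $d$-dimensional array indexed by $[n]\times[p]^{d-1}$ and $\mathbb{B}$ a $t$-dimensional array indexed by $[p]\times[q]^{t-1}$ (ordinary matrices are $2$-dimensional arrays, vectors are $1$-dimensional). Then $\mathbb{A}\circ\mathbb{B}$ is the $((d-1)(t-1)+1)$-dimensional array with entries $$c_{i,\beta^2,\dots,\beta^d}=\sum_{i_2,\dots,i_d\in[p]}a_{i,i_2,\dots,i_d}\,b_{i_2,\beta^2}\cdots b_{i_d,\beta^d},\qquad \beta^j\in[q]^{t-1}.$$ In particular, for an $n\times k$ matrix $P$ and a $d$-dimensional $\mathbb{S}$ of order $k$, $(P\circ\mathbb{S})_{x,\beta}=\sum_{i}p_{x,i}s_{i,\beta}$. A coloring is a surjective map $f:[n]\to[k]$. Its color matrix $P$ is $n\times k$ with $p_{x,i}=1$ if $f(x)=i$ and $0$ otherwise. The color range of a hyperedge $e$ is the multiset $\{f(x):x\in e\}$. The coloring $f$ is perfect if, for each color $i$ and each multiset $\gamma$, all vertices of color $i$ lie in the same number of hyperedges of color range $\gamma$. *)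

(* Defs.v *)
From HB Require Import structures.
From mathcomp Require Import all_boot all_order all_algebra.
From mathcomp Require Import finmap multiset.

Set Implicit Arguments.
Unset Strict Implicit.
Unset Printing Implicit Defensive.

Import GRing.Theory.
Local Open Scope ring_scope.

Record uhypergraph (d n : nat) := UHypergraph {
  hyperedges :> {set {set 'I_n}};
  hyperedges_uniform : forall e, e \in hyperedges -> #|e| = d
}.

(* d-dimensional arrays indexed by [n] x [p]^(d-1). Only dimensions d >= 1 are
   meaningful: because of d.-1, dimension 0 has the same index set as
   dimension 1. *)
Definition array (R : Type) (d n p : nat) : Type :=
  {ffun 'I_n * (d.-1).-tuple 'I_p -> R}.

Definition cast_array (R : Type) (d d' n p : nat) (e : d = d')
    (A : array R d n p) : array R d' n p :=
  [ffun c : 'I_n * (d'.-1).-tuple 'I_p =>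
     A (c.1, tcast (congr1 predn (esym e)) c.2)].

Fact block_index_subproof (a b : nat) (j : 'I_a) (l : 'I_b) :
  (j * b + l < a * b)%N.
Proof.
apply: (@leq_trans (j.+1 * b)%N); last by rewrite leq_mul2r ltn_ord orbT.
by rewrite mulSn addnC ltn_add2r.
Qed.

Definition block_index (a b : nat) (j : 'I_a) (l : 'I_b) : 'I_(a * b) :=
  Ordinal (block_index_subproof j l).

(* The j-th of the a consecutive blocks of length b of an index beta. *)
Definition block (T : Type) (a b : nat) (beta : (a * b).-tuple T) (j : 'I_a) :
    b.-tuple T :=
  [tuple tnth beta (block_index j l) | l < b].

Definition array_prod (R : pzSemiRingType) (d t n p q : nat)
    (A : array R d n p) (B : array R t p q) :
    array R (d.-1 * t.-1).+1 n q :=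
  [ffun c : 'I_n * (d.-1 * t.-1).-tuple 'I_q =>
     \sum_(i : (d.-1).-tuple 'I_p)
        A (c.1, i) * \prod_(j < d.-1) B (tnth i j, block c.2 j)].

Definition array_of_mx (R : Type) (n p : nat) (M : 'M[R]_(n, p)) :
    array R 2 n p :=
  [ffun c : 'I_n * 1.-tuple 'I_p => M c.1 (thead c.2)].

Fact array_prod_mxr_dim (d : nat) : (0 < d)%N -> (d.-1 * 2.-1).+1 = d.
Proof. by case: d => // d _; rewrite muln1. Qed.

Fact array_prod_mxl_dim (d : nat) : (0 < d)%N -> (2.-1 * d.-1).+1 = d.
Proof. by case: d => // d _; rewrite mul1n. Qed.

(* A o M and M o S for d-dimensional A, S and a matrix M. They have dimensions
   (d-1)*1+1 and 1*(d-1)+1, both cast to d. *)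
Definition array_mulmx (R : pzSemiRingType) (d n p q : nat) (d_gt0 : (0 < d)%N)
    (A : array R d n p) (M : 'M[R]_(p, q)) : array R d n q :=
  cast_array (array_prod_mxr_dim d_gt0) (array_prod A (array_of_mx M)).

Definition mx_mularray (R : pzSemiRingType) (d n p q : nat) (d_gt0 : (0 < d)%N)
    (M : 'M[R]_(n, p)) (S : array R d p q) : array R d n q :=
  cast_array (array_prod_mxl_dim d_gt0) (array_prod (array_of_mx M) S).

(* A hyperedge has d elements, so {x_1, ..., x_d} \in G forces the x_i to be
   distinct. *)
Definition adjacency (R : unitRingType) (d n : nat) (G : uhypergraph d n) :
    array R d n n :=
  [ffun c : 'I_n * (d.-1).-tuple 'I_n =>
     if [set x in c.1 :: c.2] \in hyperedges G
     then ((d.-1)`!%:R)^-1 else 0].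

Definition coloring (n k : nat) (f : 'I_n -> 'I_k) : Prop :=
  forall i, exists x, f x = i.

Definition color_mx (R : pzSemiRingType) (n k : nat) (f : 'I_n -> 'I_k) :
    'M[R]_(n, k) :=
  \matrix_(x, i) (f x == i)%:R.

Definition color_range (n k : nat) (f : 'I_n -> 'I_k) (e : {set 'I_n}) :
    {mset 'I_k}%mset :=
  seq_mset [seq f x | x in e].

Definition range_degree (d n k : nat) (G : uhypergraph d n) (f : 'I_n -> 'I_k)
    (x : 'I_n) (gamma : {mset 'I_k}%mset) : nat :=
  #|[set e in hyperedges G | (x \in e) && (color_range f e == gamma)]|.

Definition perfect (d n k : nat) (G : uhypergraph d n) (f : 'I_n -> 'I_k) :
    Prop :=
  forall (i : 'I_k) (gamma : {mset 'I_k}%mset) (x y : 'I_n),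
    f x = i -> f y = i -> range_degree G f x gamma = range_degree G f y gamma.

(* The division is exact when m is the sum of the m_ l. *)
Definition multinomial (k m : nat) (m_ : 'I_k -> nat) : nat :=
  (m`! %/ \prod_(l < k) (m_ l)`!)%N.

(* Main.v *)
(** For a vertex [x] and colors [b] of length [d - 1], the entry of A o P at
    [(x, b)] is [1 / (d - 1)!] times the number of tuples [t] with [f t = b]
    such that [x :: t] enumerates a hyperedge, while the entry of P o S is
    [S (f x, b)]. A hyperedge [e] through [x] is enumerated by such a tuple
    exactly when its color range is that of [f x :: b], and then in
    [d_1! ... d_k!] ways, since the rest of [e] may be permuted inside each
    color class. Hence the entry of A o P is the range degree of [x] divided by
    the multinomial coefficient, and A o P = P o S says that this degree depends
    only on [f x]. Multisets that are not of the form [f x :: b] are harmless,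
    because their range degree at [x] is zero. *)

Require Import Defs.
From mathcomp Require Import all_boot all_order all_algebra.
From mathcomp Require Import finmap multiset.

Set Implicit Arguments.
Unset Strict Implicit.
Unset Printing Implicit Defensive.

Import GRing.Theory.
Local Open Scope ring_scope.

Lemma array_mulmxE (R : pzSemiRingType) (d n p q : nat) (d_gt0 : (0 < d)%N)
    (A : array R d n p) (M : 'M[R]_(p, q)) x b :
  array_mulmx d_gt0 A M (x, b) =
  \sum_(t : (d.-1).-tuple 'I_p)
     A (x, t) * \prod_(j < d.-1) M (tnth t j) (tnth b j).
Proof.
rewrite !ffunE /=; apply: eq_bigr => t _; congr (_ * _).
apply: eq_bigr => j _; rewrite ffunE /= /thead tnth_mktuple tcastE.
(* Blocks have length 1, so the block index [j * 1 + 0] is just [j]. *)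
by congr (M _ (tnth b _)); apply: val_inj; rewrite /= muln1 addn0.
Qed.

Lemma mx_mularrayE (R : pzSemiRingType) (d n p q : nat) (d_gt0 : (0 < d)%N)
    (M : 'M[R]_(n, p)) (S : array R d p q) x b :
  mx_mularray d_gt0 M S (x, b) = \sum_i M x i * S (i, b).
Proof.
rewrite !ffunE /= (reindex (fun i : 'I_p => [tuple i])) /=; last first.
  exists (fun t => thead t) => t _ //.
  by apply: val_inj; case: t => [[|a []]].
apply: eq_bigr => i _; rewrite ffunE big_ord1 /=; congr (_ * S (_, _)).
apply: eq_from_tnth => j; rewrite tnth_mktuple tcastE.
by congr (tnth b _); apply: val_inj.
Qed.

Lemma big_tuple_cons (R : Type) (idx : R) (op : Monoid.com_law idx)
    (T : finType) (m : nat) (F : m.+1.-tuple T -> R) :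
  \big[op/idx]_t F t =
  \big[op/idx]_y \big[op/idx]_(t : m.-tuple T) F [tuple of y :: t].
Proof.
rewrite pair_big (reindex (fun p : T * m.-tuple T => [tuple of p.1 :: p.2])) //.
exists (fun t => (thead t, [tuple of behead t])) => [[y t] _|t _] /=.
  by congr pair; apply: val_inj.
by rewrite [RHS]tuple_eta.
Qed.

(** Induction on the sum: [(F i + a)!] is a binomial coefficient times [(F i)! * a!]. This makes the
    division in [multinomial] exact. *)
Lemma dvdn_prod_fact_sum (I : Type) (r : seq I) (F : I -> nat) :
  (\prod_(i <- r) (F i)`! %| (\sum_(i <- r) F i)`!)%N.
Proof.
elim/big_rec2: _ => // i a b _ dvd_b.
rewrite -(bin_fact (leq_addr a (F i))) addKn.
by rewrite dvdn_mull // dvdn_mul.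
Qed.

Lemma prod_fact_count_cons (k : nat) (b : 'I_k) (s : seq 'I_k) :
  (\prod_(l < k) (count_mem l (b :: s))`! =
   count_mem b (b :: s) * \prod_(l < k) (count_mem l s)`!)%N.
Proof.
rewrite (bigD1 b) //= [in RHS](bigD1 b) //= eqxx mulnA -factS.
by congr (_ * _)%N; apply: eq_bigr => l /negPf; rewrite eq_sym => ->.
Qed.

(* The arrangements of s lying over b are obtained by permuting s inside each
   fibre of f. *)
Lemma card_arrangements_over (T : finType) (k m : nat) (f : T -> 'I_k)
    (s : seq T) (b : m.-tuple 'I_k) :
  uniq s ->
  #|[set t : m.-tuple T | perm_eq t s & map f t == b]| =
  (perm_eq (map f s) b * \prod_(l < k) (count_mem l b)`!)%N.
Proof.
elim: m s b => [|m IHm] s b Us.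
  rewrite (tuple0 b) big1 ?muln1 //= -sum1dep_card big_mkcond /=.
  rewrite (big_pred1 [tuple]) => [|t]; last first.
    by rewrite [t]tuple0; apply/esym/eqP.
  by case: s {Us} => //= y s;
    do 2![case: (boolP (perm_eq _ _)) => [/perm_size //|_]].
case/tupleP: b => b0 b; rewrite -sum1dep_card big_mkcond big_tuple_cons /=.
(* Split by the head [y], an entry of [s] of color [b0]. The tail arranges [rem y s] over [b], and
   the number of choices of [y] supplies the factor that turns the product for [b] into the one for
   [b0 :: b]. *)
transitivity (\sum_(y in s | f y == b0)
    perm_eq (map f s) (b0 :: b)
    * \prod_(l < k) (count_mem l b)`!)%N; last first.
  rewrite sum_nat_const prod_fact_count_cons.
  case: (boolP (perm_eq _ _)) => [/permP/(_ (pred1 b0)) eqs|_]; last first.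
    by rewrite !mul0n muln0.
  rewrite !mul1n -eqs count_map -size_filter; congr (_ * _)%N.
  rewrite -(card_uniqP (filter_uniq _ Us)); apply: eq_card => y.
  by rewrite mem_filter inE andbC.
rewrite [RHS]big_mkcond; apply: eq_bigr => y _.
case: ifP => [/andP[ys /eqP fy]|ysF].
  have eqf : perm_eq (map f s) (b0 :: b) = perm_eq (map f (rem y s)) b.
    by rewrite (permPl (perm_map f (perm_to_rem ys))) /= fy perm_cons.
  rewrite eqf -(IHm _ _ (rem_uniq y Us)) -sum1dep_card [RHS]big_mkcond.
  apply: eq_bigr => t _; rewrite eqseq_cons fy eqxx /=.
  by rewrite (permPr (perm_to_rem ys)) perm_cons.
apply: big1 => t _; case: ifP => // /andP[/perm_mem/(_ y)].
by rewrite mem_head eqseq_cons => /esym ys /andP[fy _]; rewrite ys fy in ysF.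
Qed.

Lemma eq_seq_msetE (K : choiceType) (s s' : seq K) :
  (seq_mset s == seq_mset s') = perm_eq s s'.
Proof. exact/eqP/eq_seq_msetP. Qed.

(** The size condition excludes repetitions: a list of length [#|e|] that exhausts [e] is
    duplicate-free. *)
Lemma set_cons_eq_perm (T : finType) (x : T) (t : seq T) (e : {set T}) :
  size (x :: t) = #|e| -> x \in e ->
  ([set y in x :: t] == e) = perm_eq t (rem x (enum e)).
Proof.
move=> size_t xe.
have xe' : x \in enum e by rewrite mem_enum.
rewrite -(perm_cons x) -(permPr (perm_to_rem xe')).
apply/eqP/idP => [eq_e|/perm_mem eq_e]; last first.
  by apply/setP => y; rewrite inE eq_e mem_enum.
have mem_t : x :: t =i enum e by move=> y; rewrite mem_enum -eq_e in_set.
apply: uniq_perm; rewrite ?enum_uniq //.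
by rewrite (eq_uniq _ mem_t) ?enum_uniq ?size_t ?cardE.
Qed.

Lemma color_range_perm (n k : nat) (f : 'I_n -> 'I_k) (x : 'I_n)
    (e : {set 'I_n}) : x \in e ->
  color_range f e = seq_mset (f x :: map f (rem x (enum e))).
Proof.
move=> xe; rewrite /color_range; apply/eqP; rewrite eq_seq_msetE.
by rewrite -map_cons perm_map // perm_to_rem // mem_enum.
Qed.

(** Group the tuples by the hyperedge that they form with [x]. Each group consists of the
    arrangements over [b] of one hyperedge minus [x]. *)
Lemma card_colored_arrangements (d n k : nat) (d_gt0 : (0 < d)%N)
    (G : uhypergraph d n) (f : 'I_n -> 'I_k) x (b : (d.-1).-tuple 'I_k) :
  #|[set t : (d.-1).-tuple 'I_n |
      [set y in x :: t] \in hyperedges G & map f t == b]| =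
  (range_degree G f x (seq_mset (f x :: b))
   * \prod_(l < k) (count_mem l b)`!)%N.
Proof.
rewrite -sum1dep_card.
rewrite (partition_big (fun t : (d.-1).-tuple 'I_n => [set y in x :: t])
  (fun e => (e \in hyperedges G) && (x \in e))) /=; last first.
  by move=> t /andP[-> _]; rewrite inE mem_head.
rewrite /range_degree -sum1dep_card big_distrl /=.
rewrite big_mkcond [RHS]big_mkcond; apply: eq_bigr => e _.
case: (boolP (e \in _)) => //= eG; case: (boolP (x \in e)) => //= xe.
rewrite (color_range_perm f xe) eq_seq_msetE perm_cons.
transitivity (perm_eq (map f (rem x (enum e))) b *
  \prod_(l < k) (count_mem l b)`!)%N; last by case: ifP; rewrite ?mul0n ?mul1n.
rewrite -card_arrangements_over ?rem_uniq ?enum_uniq // -sum1dep_card.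
apply: eq_bigl => t; rewrite -set_cons_eq_perm //; last first.
  by rewrite /= size_tuple prednK // (hyperedges_uniform eG).
by case: (_ =P e) => [->|]; rewrite ?eG ?andbT ?andbF.
Qed.

(** Perfection quantifies over all multisets, while arrays only see those of the form [f x :: b];
    this bridges the gap. *)
Lemma range_degree_support (d n k : nat) (G : uhypergraph d n)
    (f : 'I_n -> 'I_k) x gamma :
  (0 < range_degree G f x gamma)%N ->
  exists b : (d.-1).-tuple 'I_k, gamma = seq_mset (f x :: b).
Proof.
case/card_gt0P => e; rewrite inE => /and3P[eG xe /eqP <-].
have size_rem_e : size (map f (rem x (enum e))) == d.-1.
  by rewrite size_map size_rem ?mem_enum // -cardE (hyperedges_uniform eG).
by exists (Tuple size_rem_e); apply: color_range_perm.
Qed.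

Lemma multinomial_count_mul (k : nat) (b : seq 'I_k) :
  (multinomial (size b) (fun l => count_mem l b)
   * \prod_(l < k) (count_mem l b)`! = (size b)`!)%N.
Proof.
have -> : size b = (\sum_(l < k) count_mem l b)%N.
  elim: b => [|b0 b IHb] /=; first by rewrite big1.
  by rewrite big_split /= -IHb (bigD1 b0) //= eqxx big1 // => l /negPf;
    rewrite eq_sym => ->.
exact/divnK/dvdn_prod_fact_sum.
Qed.

Lemma multinomial_count_neq0 (R : numFieldType) (k : nat) (b : seq 'I_k) :
  (multinomial (size b) (fun l => count_mem l b))%:R != 0 :> R.
Proof.
rewrite Num.Theory.pnatr_eq0; have := fact_gt0 (size b).
by rewrite -multinomial_count_mul muln_gt0 -lt0n => /andP[].
Qed.

Lemma adjacency_mul_color_mx (R : numFieldType) (d n k : nat)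
    (d_gt0 : (0 < d)%N) (G : uhypergraph d n) (f : 'I_n -> 'I_k) x b :
  array_mulmx d_gt0 (adjacency R G) (color_mx R f) (x, b) =
  (range_degree G f x (seq_mset (f x :: b)))%:R
  * ((multinomial d.-1 (fun l : 'I_k => count_mem l b))%:R)^-1.
Proof.
have := multinomial_count_mul b; rewrite size_tuple.
set p := (\prod_(l < k) _)%N; set M := multinomial _ _ => Mp.
have p_neq0 : p%:R != 0 :> R.
  rewrite Num.Theory.pnatr_eq0; have := fact_gt0 d.-1.
  by rewrite -Mp muln_gt0 lt0n => /andP[_]; rewrite lt0n.
(* Since [M * p = (d-1)!], dividing by [M] is multiplying by [p / (d-1)!]. *)
transitivity ((range_degree G f x (seq_mset (f x :: b)) * p)%:R
              * ((d.-1)`!%:R)^-1 : R); last first.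
  by rewrite -Mp !natrM invfM mulrACA divff // mulr1.
rewrite -card_colored_arrangements // array_mulmxE -sum1dep_card natr_sum.
rewrite mulr_suml [RHS]big_mkcond /=; apply: eq_bigr => t _.
rewrite ffunE /=; case: ifP => _; last by rewrite mul0r.
rewrite mul1r /=.
(* The product of entries of the color matrix is the indicator of [map f t = b]: any position where
   the colors differ contributes a zero factor. *)
case: eqP => [fb|/eqP fb].
  rewrite big1 ?mulr1 // => j _; rewrite mxE.
  have -> : tnth b j = tnth (map_tuple f t) j by congr tnth; apply: val_inj.
  by rewrite tnth_map eqxx.
suff [j fj] : exists j, f (tnth t j) != tnth b j.
  by rewrite (bigD1 j) //= mxE (negPf fj) mul0r mulr0.
apply/existsP; apply: contraNT fb => /existsPn eq_fb.
apply/eqP/(congr1 val (_ : map_tuple f t = b)); apply: eq_from_tnth => j.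
by rewrite tnth_map; apply/eqP; rewrite -[_ == _]negbK eq_fb.
Qed.

Lemma color_mx_mularrayE (R : pzSemiRingType) (d n k : nat)
    (d_gt0 : (0 < d)%N) (f : 'I_n -> 'I_k) (S : array R d k k) x b :
  mx_mularray d_gt0 (color_mx R f) S (x, b) = S (f x, b).
Proof.
rewrite mx_mularrayE (bigD1 (f x)) //= mxE eqxx mul1r big1 ?addr0 // => i.
by rewrite mxE eq_sym => /negPf->; rewrite mul0r.
Qed.

Theorem theorem5 (R : numFieldType) (d n k : nat) (d_gt0 : (0 < d)%N)
    (G : uhypergraph d n) (f : 'I_n -> 'I_k) (f_col : coloring f) :
  (perfect G f <->
     exists S : array R d k k,
       array_mulmx d_gt0 (adjacency R G) (color_mx R f)
         = mx_mularray d_gt0 (color_mx R f) S)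
  /\
  (forall S : array R d k k,
     array_mulmx d_gt0 (adjacency R G) (color_mx R f)
       = mx_mularray d_gt0 (color_mx R f) S ->
     forall (gamma1 : 'I_k) (gamma' : (d.-1).-tuple 'I_k) (x : 'I_n),
       f x = gamma1 ->
       S (gamma1, gamma')
         = (range_degree G f x (seq_mset (gamma1 :: gamma')))%:R
           * ((multinomial d.-1 (fun l : 'I_k => count_mem l gamma'))%:R)^-1).
Proof.
have S_entries (S : array R d k k) :
    array_mulmx d_gt0 (adjacency R G) (color_mx R f)
      = mx_mularray d_gt0 (color_mx R f) S ->
    forall (gamma1 : 'I_k) (gamma' : (d.-1).-tuple 'I_k) (x : 'I_n),
    f x = gamma1 ->
    S (gamma1, gamma')
      = (range_degree G f x (seq_mset (gamma1 :: gamma')))%:R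
        * ((multinomial d.-1 (fun l : 'I_k => count_mem l gamma'))%:R)^-1.
  move=> defS i b x <-.
  by rewrite -adjacency_mul_color_mx defS color_mx_mularrayE.
split=> //; split=> [f_perf|[S defS] i gamma x y fx fy].
  (* Surjectivity gives a representative vertex [g i] of each color; by perfection the degrees do
     not depend on this choice. *)
  have [g fg] := fin_all_exists f_col.
  exists [ffun c : 'I_k * (d.-1).-tuple 'I_k =>
           (range_degree G f (g c.1) (seq_mset (c.1 :: c.2)))%:R
           * ((multinomial d.-1 (fun l : 'I_k => count_mem l c.2))%:R)^-1].
  apply/ffunP => -[x b].
  rewrite adjacency_mul_color_mx color_mx_mularrayE ffunE /=.
  by congr (_%:R * _); apply: (f_perf (f x)).
(* Both degrees yield the same entry of [S]; the multinomial cancels, and naturals embed in [R],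
   which has characteristic 0. *)
have eq_degree (b : (d.-1).-tuple 'I_k) :
    range_degree G f x (seq_mset (i :: b)) =
    range_degree G f y (seq_mset (i :: b)).
  apply/eqP; rewrite -(Num.Theory.eqr_nat R); apply/eqP.
  have := multinomial_count_neq0 R b; rewrite size_tuple => /invr_neq0/mulIf.
  by apply; rewrite -(S_entries S defS i b x fx) (S_entries S defS i b y fy).
(* If either degree is positive, [gamma] has the form [i :: b] and [eq_degree] applies; otherwise
   both are zero. *)
have [dx|] := posnP (range_degree G f x gamma); last first.
  by case/range_degree_support => b ->; rewrite fx.
have [dy|] := posnP (range_degree G f y gamma); first by rewrite dx.
by case/range_degree_support => b ->; rewrite fy.
Qed.
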